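(* Let $G=\langle A,\beta\mid \beta^2=\alpha,\ \beta a\beta^{-1}=f(a)\ \text{for all } a\in A\rangle$ be a finite non-abelian group of order $2n$ ($n>1$), where $A$ is an abelian subgroup of index $2$, $\alpha\in A$, and $f$ is an automorphism of $A$ of order $2$ with $f(\alpha)=\alpha$. Let $X\subseteq A\setminus\{e\}$ and $Y\subseteq A$, and suppose that the Cayley graph $\Gamma=\mathrm{Cay}(G,X\cup Y\beta)$ is a DSRG with parameters $(2n,k,\mu,\lambda,t)$. Then: (i) For every non-trivial $\chi\in\mathrm{Irr}(A)$: if $\chi(\overline{Y})\neq 0$ then $\chi(\overline{X}+f(\overline{X}))=\lambda-\mu$, and if $\chi(\overline{Y})=0$ then $\chi(\overline{X}),\chi(f(\overline{X}))\in\{|X|-|Y|,\ (\lambda-\mu)-(|X|-|Y|)\}$. (ii) The Cayley multigraph $\Gamma'=\mathrm{Cay}(A,X\sqcup f(X))$ is undirected, i.e. the multiset $X\sqcup f(X)$ is inverse closed, and all possible eigenvalues of $\Gamma'$ are $2|X|$ (with multiplicity $1$), $\lambda-\mu$, $2(|X|-|Y|)$ and $2[(\lambda-\mu)-(|X|-|Y|)]$. In particular, if $\chi(\overline{Y})\neq 0$ for all non-trivial $\chi\in\mathrm{Irr}(A)$, then $\Gamma'$ has exactly two distinct eigenvalues, $2|X|$ (with multiplicity $1$) and $\lambda-\mu$.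
   Context: $e$ denotes the identity. For a finite group $H$ and a multiset $S$ of elements of $H\setminus\{e\}$, the Cayley (multi)graph $\mathrm{Cay}(H,S)$ is the directed graph with vertex set $H$ in which the number of arcs from $x$ to $y$ equals the multiplicity of $yx^{-1}$ in $S$; its eigenvalues are those of its adjacency matrix (entry $(x,y)$ = number of arcs $x\to y$). $Y\beta=\{y\beta: y\in Y\}$. A directed strongly regular graph (DSRG) with parameters $(N,k,\mu,\lambda,t)$ is a $k$-regular loopless directed graph on $N$ vertices such that every vertex $x$ has exactly $t$ vertices $z$ with $x\to z$ and $z\to x$, and for all vertices $x\ne y$ the number of $z$ with $x\to z\to y$ equals $\lambda$ if $x\to y$ and $\mu$ otherwise; throughout it is assumed that $0<t<k$. For a multiset $X$ of elements of $A$, $\overline{X}=\sum_{x}\Delta_X(x)\,x\in\mathbb{C}A$ where $\Delta_X(x)$ is the multiplicity of $x$; $f$ is extended linearly to $\mathbb{C}A$ by $f(\sum c_a a)=\sum c_a f(a)$, and $f(X)=\{f(x):x\in X\}$. For $\chi\in\mathrm{Irr}(A)$ (irreducible complex characters of $A$) and $\sum c_a a\in\mathbb{C}A$, $\chi(\sum c_a a)=\sum c_a\chi(a)$. $X\sqcup f(X)$ denotes the multiset union of $X$ and $f(X)$.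
   Formalization: In (ii), 2|X| is listed once in the spectrum, the remaining eigenvalues being among the other three values; multiplicity exactly 1 is claimed only if 2|X| ≠ 2[(λ−μ)−(|X|−|Y|)] (it can fail otherwise) and, without this condition, in the ''in particular'' case. *)

(* Defs.v *)
(* Complex characters and eigenvalues take values in algC, the algebraic numbers. *)
From HB Require Import structures.
From mathcomp Require Import all_boot all_order all_algebra all_fingroup.
From mathcomp Require Import all_solvable all_field all_character.

Set Implicit Arguments.
Unset Strict Implicit.
Unset Printing Implicit Defensive.

Import Order.TTheory GRing.Theory Num.Theory.
Local Open Scope ring_scope.

Section Digraphs.
Variable T : finType.

(* "k-regular" means in-degree and out-degree k; the standing assumption
   0 < t < k is part of the definition. *)
Definition is_dsrg (V : {set T}) (arc : rel T) (N k mu la t : nat) : Prop :=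
  [/\ #|V| = N,
      {in V, forall x, ~~ arc x x},
      {in V, forall x, #|[set z in V | arc x z]| = k
                    /\ #|[set z in V | arc z x]| = k},
      {in V, forall x, #|[set z in V | arc x z && arc z x]| = t}
    & {in V &, forall x y, x != y ->
         #|[set z in V | arc x z && arc z y]| = if arc x y then la else mu}]
  /\ (0 < t < k)%N.

(* A multigraph is given by its arc multiplicities. *)
Definition undirected (V : {set T}) (arcs : T -> T -> nat) : Prop :=
  {in V &, forall x y, arcs x y = arcs y x}.

Definition adjacency (V : {set T}) (arcs : T -> T -> nat) : 'M[algC]_#|V| :=
  \matrix_(i, j) (arcs (enum_val i) (enum_val j))%:R.

End Digraphs.

Section Groups.
Variable gT : finGroupType.

(* Multisets of group elements are multiplicity functions gT -> nat. *)
Definition mset_of (S : {set gT}) : gT -> nat := fun a => a \in S.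

Definition mset_union (D E : gT -> nat) : gT -> nat := fun a => (D a + E a)%N.

Definition inverse_closed (D : gT -> nat) : Prop :=
  forall a, D a^-1%g = D a.

Definition cay (S : {set gT}) : rel gT :=
  [rel x y | (y * x^-1)%g \in S].

Definition cay_arcs (D : gT -> nat) (x y : gT) : nat :=
  D (y * x^-1)%g.

(* The formal sum of the c_a a is the finite function a |-> c_a. *)
Definition mset_sum (D : gT -> nat) : {ffun gT -> algC} :=
  [ffun a => (D a)%:R].

Definition galg_map (f : gT -> gT) (c : {ffun gT -> algC}) : {ffun gT -> algC} :=
  [ffun b => \sum_(a | f a == b) c a].

Definition galg_char (A : {group gT}) (chi : 'CF(A))
    (c : {ffun gT -> algC}) : algC :=
  \sum_(a in A) c a * chi a.

End Groups.

(* s lists the eigenvalues of M, each repeated according to its multiplicity. *)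
Definition spectrum n (M : 'M[algC]_n) (s : seq algC) : Prop :=
  char_poly M = \prod_(z <- s) ('X - z%:P).

(* Main.v *)
(* Write [S = X + Y beta] and [S^2 = t e + la S + mu (G - e - S)] in the group
   algebra and separate the components in [A] and [A beta]:
     [X^2 + alpha Y f(Y) = (t - mu) e + (la - mu) X + mu A],
     [Y (X + f(X)) = (la - mu) Y + mu A].
   A nontrivial character [chi] kills [A].  The second equation then gives
   [chi(X + f(X)) = la - mu] when [chi(Y) != 0]; when [chi(Y) = 0] the first one,
   for [chi] and [chi o f], says that [chi(X)] and [chi(f(X))] are roots of
   [z^2 = (t - mu) + (la - mu) z].  Subtracting the two equations at the trivial
   character shows that [|X| - |Y|] is one root of it, so the other is
   [(la - mu) - (|X| - |Y|)].  All the values [chi(X + f(X))] are therefore real,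
   which makes the multiset inverse closed, and they are the eigenvalues of the
   Cayley multigraph because the characters diagonalise it.
   Simplicity of [2|X|] rests on [mu > 0]: if [mu = 0] then [k^2 = t + la k], so
   [k] divides [t], against [0 < t < k]. *)
Require Import Defs.
From mathcomp Require Import all_boot all_order all_algebra all_fingroup.
From mathcomp Require Import all_solvable all_field all_character.
From mathcomp Require Import ring.

Set Implicit Arguments.
Unset Strict Implicit.
Unset Printing Implicit Defensive.

Import Order.TTheory GRing.Theory Num.Theory.
Local Open Scope ring_scope.

(** * Characters of an abelian group and Cayley spectra *)

Lemma char_poly_intertwined (F : fieldType) (n : nat) (M P D : 'M[F]_n) :
  P \in unitmx -> M *m P = P *m D -> char_poly M = char_poly D.
Proof.
move=> uP eMP; rewrite /char_poly.
have nzP : \det (map_mx polyC P) != 0.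
  by rewrite det_map_mx polyC_eq0; move: uP; rewrite unitmxE unitfE.
apply: (mulIf nzP); rewrite -det_mulmx [RHS]mulrC -det_mulmx /char_poly_mx.
by rewrite mulmxBl mulmxBr scalar_mxC -!map_mxM eMP.
Qed.

(** Irreducible characters of an abelian group are multiplicative, so each one, read as a column
    vector, is an eigenvector; the character table [P] diagonalises the adjacency matrix. *)
Lemma char_poly_cay_abelian (gT : finGroupType) (A : {group gT})
    (D : gT -> nat) (abA : abelian A) :
  char_poly (adjacency A (cay_arcs D)) =
    \prod_(i : Iirr A) ('X - (galg_char 'chi_i (mset_sum D))%:P).
Proof.
have eN : #|A| = Nirr A.
  by apply/eqP; rewrite NirrE eq_sym -card_classes_abelian.
pose c := cast_ord eN.
pose ev j : algC := galg_char 'chi_(c j) (mset_sum D).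
pose P : 'M[algC]_#|A| := \matrix_(i, j) 'chi_(c j) (enum_val i).
have uP : P \in unitmx.
  (* The first orthogonality relation exhibits the inverse of the character table. *)
  pose Q : 'M[algC]_#|A| :=
    \matrix_(i, j) (#|A|%:R^-1 * ('chi_(c i) (enum_val j))^*).
  suff /mulmx1_unit[_ //] : Q *m P = 1%:M.
  apply/matrixP=> i j; rewrite !mxE.
  under eq_bigr do rewrite !mxE -mulrA [_^* * _]mulrC.
  rewrite -mulr_sumr.
  rewrite -(big_enum_val (fun x => 'chi_(c j) x * ('chi_(c i) x)^*)).
  rewrite -cfdotE cfdot_irr; congr (nat_of_bool _)%:R.
  by rewrite eq_sym (inj_eq (@cast_ord_inj _ _ _)).
have eMP : adjacency A (cay_arcs D) *m P = P *m diag_mx (\row_j ev j).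
  apply/matrixP=> i j; rewrite mul_mx_diag !mxE.
  under eq_bigr do rewrite !mxE.
  have lin := char_abelianP _ abA (c j).
  have iA := enum_valP i.
  rewrite -(big_enum_val (fun y => (cay_arcs D (enum_val i) y)%:R
    * 'chi_(c j) y)) /=.
  (* Substituting [y = a * x], with [x] the row element, factors [chi x] out of the sum. *)
  rewrite (reindex_inj (mulIg (enum_val i))) /= /ev /galg_char mulr_sumr.
  under eq_bigl do rewrite groupMr //.
  apply: eq_bigr => a aA.
  by rewrite ffunE /cay_arcs mulgK (lin_charM lin) // [RHS]mulrC mulrA.
rewrite (char_poly_intertwined uP eMP) char_poly_trig ?diag_mx_is_trig //.
rewrite [RHS](reindex c) /=; last first.
  apply: onW_bij; exists (cast_ord (esym eN)); first exact: cast_ordK.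
  exact: cast_ordKV.
by apply: eq_bigr => j _; rewrite !mxE eqxx.
Qed.

(** Fourier inversion, from column orthogonality: conjugacy classes are singletons, so only the
    coefficient at [a] survives. *)
Lemma galg_char_inversion (gT : finGroupType) (A : {group gT})
    (c : {ffun gT -> algC}) (a : gT) (abA : abelian A) (aA : a \in A) :
  #|A|%:R * c a = \sum_i galg_char 'chi[A]_i c * ('chi_i a)^*.
Proof.
rewrite /galg_char; under eq_bigr do rewrite mulr_suml.
rewrite exchange_big /= (bigD1 a) //= [X in _ + X]big1 ?addr0 => [|b /andP[bA neq_ba]].
  under eq_bigr do rewrite -mulrA.
  rewrite -mulr_sumr second_orthogonality_relation // class_refl mulrC.
  by rewrite (setIidPl _) // sub_cent1 (subsetP abA).
under eq_bigr do rewrite -mulrA.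
rewrite -mulr_sumr second_orthogonality_relation //.
have -> : (a ^: A)%g = [set a].
  apply/setP=> x; rewrite inE; apply/imsetP/eqP => [[y yA ->]|->].
    by rewrite /conjg (centsP abA a) // mulKg.
  by exists 1%g; rewrite ?conjg1.
by rewrite inE (negPf neq_ba) mulr0.
Qed.

(** Passing from [a] to [a^-1] conjugates [chi a]. In the inversion formula this conjugates the
    whole sum, since the transforms are real, and the real coefficient is unchanged. *)
Lemma real_galg_char_sym (gT : finGroupType) (A : {group gT})
    (c : {ffun gT -> algC}) (abA : abelian A)
    (real_c : forall a, c a \is Num.real)
    (real_char : forall i : Iirr A, galg_char 'chi_i c \is Num.real) :
  {in A, forall a, c a^-1%g = c a}.
Proof.
move=> a aA; have nzA : #|A|%:R != 0 :> algC := neq0CG A.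
apply: (mulfI nzA); rewrite galg_char_inversion ?groupV //.
transitivity ((#|A|%:R * c a)^*).
  rewrite galg_char_inversion // rmorph_sum /=; apply: eq_bigr => i _.
  rewrite (lin_charV_conj (char_abelianP _ abA i)) // rmorphM /=.
  by rewrite (CrealP (real_char i)).
by rewrite rmorphM rmorph_nat /= (CrealP (real_c a)).
Qed.

Lemma sum_nontrivial_irr (gT : finGroupType) (A : {group gT}) (i : Iirr A) :
  i != 0 -> \sum_(a in A) 'chi_i a = 0.
Proof.
move=> nz_i; have := cfdot_irr i 0; rewrite (negPf nz_i) irr0 cfdotE.
under eq_bigr => a aA do rewrite cfun1E aA conjC1 mulr1.
by move/eqP; rewrite mulf_eq0 invr_eq0 (negPf (neq0CG A)) => /eqP.
Qed.

Lemma sum_irr0 (gT : finGroupType) (A : {group gT}) (Z : {set gT})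
    (h : gT -> gT) :
  {in Z, forall z, h z \in A} -> \sum_(z in Z) 'chi[A]_0 (h z) = #|Z|%:R.
Proof.
move=> hA; rewrite -sumr_const irr0; apply: eq_bigr => z /hA hzA.
by rewrite cfun1E hzA.
Qed.

(** * The group algebra identity of a Cayley DSRG *)

(** This is the identity for [S^2], paired with an arbitrary function [F]; the choice of [F] then
    extracts a component or a character value. *)
Lemma dsrg_cay_sum (gT : finGroupType) (G : {group gT}) (S : {set gT})
    (N k mu la t : nat) (F : gT -> algC) (sSG : S \subset G) :
  is_dsrg G (cay S) N k mu la t ->
  \sum_(s in S) \sum_(r in S) F (r * s)%g =
    (t%:R - mu%:R) * F 1%g + (la%:R - mu%:R) * (\sum_(s in S) F s)
    + mu%:R * \sum_(g in G) F g.
Proof.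
case=> [[_ loopless _ two_way paths] _].
have G1 := group1 G.
have S'1 : 1%g \notin S by have := loopless _ G1; rewrite /cay /= mulgV.
(* A factorisation [g = r * s] in [S] is a path from [1] through [s] to [g]. At [g = 1] these are
   the two-way arcs, counted by [t]. *)
have count_paths g : g \in G ->
    #|[set z in S | (g * z^-1)%g \in S]|%:R
    = (g == 1%g)%:R * (t%:R - mu%:R) + (g \in S)%:R * (la%:R - mu%:R)
      + mu%:R :> algC.
  move=> gG.
  have -> : [set z in S | (g * z^-1)%g \in S]
          = [set z in G | cay S 1%g z && cay S z g].
    apply/setP=> z; rewrite !inE /cay /= invg1 mulg1.
    by case zS: (z \in S); rewrite ?andbF // (subsetP sSG).
  case: (eqVneq g 1%g) => [->|nt_g].
    by rewrite (two_way _ G1) (negPf S'1) mul1r mul0r addr0 subrK.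
  rewrite paths // 1?eq_sym // /cay /= invg1 mulg1.
  by case: (g \in S); rewrite ?mul0r ?add0r // mul1r subrK.
transitivity (\sum_(g in G) #|[set z in S | (g * z^-1)%g \in S]|%:R * F g).
  transitivity (\sum_(s in S) \sum_(g in G) ((g * s^-1)%g \in S)%:R * F g).
    apply: eq_bigr => s sS; have sG := subsetP sSG s sS.
    rewrite [RHS](reindex_inj (mulIg s)) /=.
    under [RHS]eq_bigl do rewrite groupMr //.
    under [RHS]eq_bigr do rewrite mulgK.
    rewrite big_mkcond [RHS]big_mkcond /=; apply: eq_bigr => r _.
    case rS: (r \in S); last by rewrite mul0r if_same.
    by rewrite (subsetP sSG) // mul1r.
  rewrite exchange_big; apply: eq_bigr => g gG /=.
  rewrite -mulr_suml -natr_sum -sum1_card; congr (_%:R * _).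
  rewrite big_mkcond [RHS]big_mkcond; apply: eq_bigr => z _ /=.
  by rewrite inE; case: (z \in S); case: (_ \in S).
transitivity (\sum_(g in G) ((g == 1%g)%:R * ((t%:R - mu%:R) * F g)
    + (g \in S)%:R * ((la%:R - mu%:R) * F g) + mu%:R * F g)).
  by apply: eq_bigr => g gG; rewrite count_paths //; ring.
rewrite !big_split /= -mulr_sumr; congr (_ + _ + _).
  rewrite (bigD1 1%g) //= eqxx mul1r big1 ?addr0 // => g /andP[_ /negPf->].
  by rewrite mul0r.
rewrite mulr_sumr big_mkcond [RHS]big_mkcond; apply: eq_bigr => g _ /=.
case gS: (g \in S); last by rewrite mul0r if_same.
by rewrite (subsetP sSG) // mul1r.
Qed.

Lemma dsrg_cay_mu_gt0 (gT : finGroupType) (G : {group gT}) (S : {set gT})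
    (N k mu la t : nat) (sSG : S \subset G) :
  is_dsrg G (cay S) N k mu la t -> (0 < mu)%N.
Proof.
move=> dsrg; have := dsrg_cay_sum (fun=> 1) sSG dsrg.
case: dsrg => [[_ _ degree _ _] /andP[t_gt0 lt_tk]].
have cardS : #|S| = k.
  have [<- _] := degree _ (group1 G); apply: eq_card => z.
  rewrite !inE /cay /= invg1 mulg1.
  by case zS: (z \in S); rewrite ?andbF // (subsetP sSG).
rewrite !sumr_const cardS; case: mu => // /eqP.
rewrite !subr0 mul0r addr0 mulr1 -mulrnA -natrM -natrD eqr_nat.
move=> /eqP eq_kk; have : (k %| t + la * k)%N by rewrite -eq_kk dvdn_mull.
by rewrite dvdn_addl ?dvdn_mull // => /(dvdn_leq t_gt0); rewrite leqNgt lt_tk.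
Qed.

Lemma sum_setU_rcoset (gT : finGroupType) (A : {group gT}) (X Y : {set gT})
    (b : gT) (H : gT -> algC) (sXA : X \subset A) (sYA : Y \subset A)
    (bA : b \notin A) :
  \sum_(s in X :|: (Y :* b)%g) H s
  = \sum_(x in X) H x + \sum_(y in Y) H (y * b)%g.
Proof.
rewrite (eq_bigl [predU X & (Y :* b)%g]) => [|s]; last by rewrite !inE.
rewrite bigU /=; last first.
  rewrite -setI_eq0; apply/eqP/setP=> s; rewrite !inE mem_rcoset.
  apply/negP=> /andP[/(subsetP sXA) sA /(subsetP sYA)].
  by rewrite groupMl // groupV (negPf bA).
congr (_ + _); rewrite (reindex_inj (mulIg b)) /=.
by apply: eq_bigl => y; rewrite mem_rcoset mulgK.
Qed.

(* [phi] stands for a linear character of [A] extended by zero; the two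
   equations are its values on the [A]- and [A b]-components of the identity
   [S^2 = t e + la S + mu (G - e - S)] for [S = X + Y b]. *)
Lemma dsrg_character_equations (gT : finGroupType) (G A : {group gT})
    (X Y : {set gT}) (b : gT) (f : gT -> gT) (phi : gT -> algC)
    (N k mu la t : nat)
    (sXA : X \subset A) (sYA : Y \subset A) (bA : b \notin A)
    (defG : G :=: A :|: (A :* b)%g) (b2A : (b * b)%g \in A)
    (fA : forall a, a \in A -> f a \in A)
    (conj_b : forall a, a \in A -> (b * a * b^-1)%g = f a)
    (phi1 : phi 1%g = 1)
    (phiM : {in A &, forall a c, phi (a * c)%g = phi a * phi c})
    (phi0 : forall g, g \notin A -> phi g = 0) :
  is_dsrg G (cay (X :|: (Y :* b)%g)) N k mu la t ->
  (\sum_(x in X) phi x) ^+ 2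
    + (\sum_(y in Y) phi (f y)) * (\sum_(y in Y) phi y) * phi (b * b)%g
  = t%:R - mu%:R + (la%:R - mu%:R) * (\sum_(x in X) phi x)
    + mu%:R * \sum_(a in A) phi a
  /\ (\sum_(y in Y) phi y) * (\sum_(x in X) phi x + \sum_(x in X) phi (f x))
  = (la%:R - mu%:R) * (\sum_(y in Y) phi y) + mu%:R * \sum_(a in A) phi a.
Proof.
move=> dsrg.
have sSG : X :|: (Y :* b)%g \subset G.
  by rewrite defG setUSS // mulSg.
have XA x : x \in X -> x \in A := subsetP sXA x.
have YA y : y \in Y -> y \in A := subsetP sYA y.
have bM a : a \in A -> (b * a = f a * b)%g.
  by move=> aA; rewrite -conj_b // mulgKV.
have off a : a \in A -> phi (a * b)%g = 0.
  by move=> aA; rewrite phi0 // groupMl.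
have offV a : a \in A -> phi (a * b^-1)%g = 0.
  by move=> aA; rewrite phi0 // groupMl ?groupV.
have sumU := sum_setU_rcoset (b := b) _ _ _ bA.
split.
  (* Since [phi] vanishes off [A], only products landing in [A] contribute: those from [X X] and
     [Y b Y b]. *)
  have := dsrg_cay_sum phi sSG dsrg; rewrite defG !sumU // phi1 mulr1.
  rewrite [X in _ = _ + _ * (_ + X) + _]big1 => [|y /YA /off //].
  rewrite [X in _ = _ + _ + _ * (_ + X)]big1 => [|a /off //].
  rewrite !addr0 => <-; congr (_ + _).
    rewrite expr2 mulr_suml; apply: eq_bigr => x /XA xA.
    rewrite sumU // [X in _ = _ + X]big1 ?addr0 => [|y /YA yA].
      by rewrite mulr_sumr; apply: eq_bigr => x' /XA x'A; rewrite phiM // mulrC.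
    by rewrite -mulgA bM // mulgA off // groupM ?fA.
  rewrite -mulrA mulr_suml; apply: eq_bigr => y /YA yA.
  rewrite sumU // [X in _ = X + _]big1 ?add0r => [|x /XA xA].
    rewrite mulr_suml mulr_sumr; apply: eq_bigr => y' /YA y'A.
    have -> : (y' * b * (y * b) = y' * f y * (b * b))%g.
      by rewrite !mulgA -(mulgA y') bM // !mulgA.
    by rewrite (phiM _ _ (groupM y'A (fA _ yA)) b2A) (phiM _ _ y'A (fA _ yA)); ring.
  by rewrite mulgA off // groupM.
(* The translate of [phi] by [b] is supported on [A b], so it sees only the mixed products. *)
have := dsrg_cay_sum (fun g => phi (g * b^-1)%g) sSG dsrg.
rewrite defG !sumU // mul1g phi0 ?groupV // mulr0 add0r.
rewrite [X in _ = _ * (X + _) + _]big1 ?add0r => [|x /XA /offV //].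
rewrite [X in _ = _ + _ * (X + _)]big1 ?add0r => [|a /offV //].
under [X in _ = _ * X + _]eq_bigr do rewrite mulgK.
under [X in _ = _ + _ * X]eq_bigr do rewrite mulgK.
move=> <-; rewrite mulrDr addrC; congr (_ + _).
  rewrite mulr_sumr; apply: eq_bigr => x /XA xA.
  rewrite sumU // [X in _ = X + _]big1 ?add0r => [|x' /XA x'A].
    rewrite mulr_suml; apply: eq_bigr => y /YA yA.
    by rewrite -phiM ?fA // -conj_b // !mulgA.
  by rewrite offV // groupM.
rewrite mulr_suml; apply: eq_bigr => y /YA yA.
rewrite sumU // [X in _ = _ + X]big1 ?addr0 => [|y' /YA y'A].
  rewrite mulr_sumr; apply: eq_bigr => x /XA xA.
  by rewrite mulgA mulgK phiM // mulrC.
by rewrite mulgA mulgK -mulgA bM // mulgA off // groupM ?fA.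
Qed.

(** * Formal sums of sets, and roots of a quadratic *)

Lemma galg_char_set (gT : finGroupType) (A : {group gT}) (chi : 'CF(A))
    (Z : {set gT}) :
  Z \subset A -> galg_char chi (mset_sum (mset_of Z)) = \sum_(z in Z) chi z.
Proof.
move=> sZA; rewrite /galg_char big_mkcond [RHS]big_mkcond; apply: eq_bigr => a _.
rewrite ffunE /mset_of; case aZ: (a \in Z); last by rewrite mul0r if_same.
by rewrite (subsetP sZA) // mul1r.
Qed.

Lemma galg_map_set (gT : finGroupType) (f : {perm gT}) (Z : {set gT}) :
  galg_map f (mset_sum (mset_of Z)) = mset_sum (mset_of (f @: Z)).
Proof.
apply/ffunP=> b; rewrite !ffunE (big_pred1 (f^-1%g b)) => [|a]; last first.
  by rewrite (canF_eq (permK f)).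
by rewrite ffunE /mset_of -{2}(permKV f b) mem_imset //; apply: perm_inj.
Qed.

Lemma mset_sumD (gT : finGroupType) (D E : gT -> nat) :
  mset_sum (mset_union D E) = mset_sum D + mset_sum E.
Proof. by apply/ffunP=> a; rewrite !ffunE natrD. Qed.

Lemma galg_charD (gT : finGroupType) (A : {group gT}) (chi : 'CF(A))
    (c d : {ffun gT -> algC}) :
  galg_char chi (c + d) = galg_char chi c + galg_char chi d.
Proof.
by rewrite -big_split; apply: eq_bigr => a _; rewrite ffunE mulrDl.
Qed.

(** By Vieta the two roots sum to [c]. *)
Lemma mem_quadratic_roots (F : fieldType) (c d x z : F) :
  x ^+ 2 = d + c * x -> z ^+ 2 = d + c * z -> z \in [:: x; c - x].
Proof.
move=> ex ez; rewrite !inE -subr_eq0 -[z == c - x]subr_eq0 -mulf_eq0.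
suff -> : (z - x) * (z - (c - x)) = (z ^+ 2 - c * z) - (x ^+ 2 - c * x).
  by rewrite ex ez !addrK subrr.
by ring.
Qed.

Theorem theorem1 (gT : finGroupType) (G A : {group gT}) (n : nat)
    (alpha beta : gT) (f : {perm gT}) (X Y : {set gT}) (k mu la t : nat)
    (hn : (1 < n)%N)
    (hG : #|G| = (2 * n)%N)
    (hGna : ~~ abelian G)
    (hgen : G :=: <<beta |: A>>%g)
    (hAab : abelian A)
    (hAidx : #|G : A|%g = 2%N)
    (halpha : alpha \in A)
    (hbeta : (beta ^+ 2)%g = alpha)
    (hf : f \in Aut A)
    (hf2 : #[f]%g = 2%N)
    (hfalpha : f alpha = alpha)
    (hconj : forall a, a \in A -> (beta * a * beta^-1)%g = f a)
    (hX : X \subset (A :\ 1)%g)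
    (hY : Y \subset A)
    (hdsrg : is_dsrg G (cay (X :|: (Y :* beta)%g)) (2 * n) k mu la t) :
  let Xbar := mset_sum (mset_of X) in
  let Ybar := mset_sum (mset_of Y) in
  let XfX := mset_union (mset_of X) (mset_of (f @: X)) in
  let Gamma' := adjacency A (cay_arcs XfX) in
  let lm : algC := la%:R - mu%:R in
  let xy : algC := #|X|%:R - #|Y|%:R in
  let xx : algC := 2 * #|X|%:R in
  (* (i) *)
  (forall i : Iirr A, i != 0 ->
      (galg_char 'chi_i Ybar != 0 ->
         galg_char 'chi_i (Xbar + galg_map f Xbar) = lm)
   /\ (galg_char 'chi_i Ybar = 0 ->
         galg_char 'chi_i Xbar \in [:: xy; lm - xy]
      /\ galg_char 'chi_i (galg_map f Xbar) \in [:: xy; lm - xy]))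
  (* (ii) *)
  /\ (undirected A (cay_arcs XfX) /\ inverse_closed XfX)
  /\ (forall z : algC, eigenvalue Gamma' z ->
        z \in [:: xx; lm; 2 * xy; 2 * (lm - xy)])
  (* 2|X| is listed once, the other n - 1 eigenvalues being among the last
     three values *)
  /\ (exists s : seq algC,
        spectrum Gamma' (xx :: s)
        /\ {subset s <= [:: lm; 2 * xy; 2 * (lm - xy)]})
  (* hence 2|X| is a simple eigenvalue, unless the last value equals 2|X| *)
  /\ (xx != 2 * (lm - xy) -> mup xx (char_poly Gamma') = 1%N)
  /\ ((forall i : Iirr A, i != 0 -> galg_char 'chi_i Ybar != 0) ->
        [/\ xx != lm,
            (forall z : algC, eigenvalue Gamma' z <-> z = xx \/ z = lm)
          & mup xx (char_poly Gamma') = 1%N]).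

Proof.
move=> Xbar Ybar XfX Gamma' lm xy xx.
have sAG : A \subset G by rewrite hgen (subset_trans _ (subset_gen _)) ?subsetUr.
have bA : beta \notin A.
  apply/negP=> bA; move: hAidx; rewrite hgen (setUidPr _) ?sub1set //.
  by rewrite genGid indexgg.
have bG : beta \in G by rewrite hgen mem_gen // setU11.
have b2A : (beta * beta)%g \in A by move: halpha; rewrite -hbeta.
have fA a : a \in A -> f a \in A by move=> aA; rewrite Aut_closed.
have fK : involutive f.
  by move=> a; rewrite -permM -[(f * f)%g]/(f ^+ 2)%g -hf2 expg_order perm1.
have sXA : X \subset A := subset_trans hX (subsetDl _ _).
have sfXA : f @: X \subset A.
  by apply/subsetP=> _ /imsetP[x /(subsetP sXA)/fA fxA ->].
(* The two cosets are disjoint subsets of [G], and index 2 makes their sizes add up to that of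
   [G]. *)
have defG : G :=: A :|: (A :* beta)%g.
  apply/eqP; rewrite eq_sym eqEcard subUset sAG mul_subG ?sub1set //=.
  rewrite -(Lagrange sAG) hAidx cardsU (_ : A :&: _ = set0) => [|].
    by rewrite cards0 subn0 card_rcoset addnn muln2.
  apply/setP=> a; rewrite !inE mem_rcoset; apply/negP=> /andP[aA].
  by rewrite groupMl // groupV (negPf bA).

(* Character values of [X], [f(X)] and [Y] *)
have lin i : 'chi[A]_i \is a linear_char by apply/char_abelianP.
pose pX (i : Iirr A) := \sum_(x in X) 'chi_i x.
pose pfX (i : Iirr A) := \sum_(x in X) 'chi_i (f x).
pose pY (i : Iirr A) := \sum_(y in Y) 'chi_i y.
have gX i : galg_char 'chi_i Xbar = pX i by apply: galg_char_set.
have gY i : galg_char 'chi_i Ybar = pY i by apply: galg_char_set.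
have gfX i : galg_char 'chi_i (galg_map f Xbar) = pfX i.
  rewrite galg_map_set galg_char_set // big_imset //=.
  by move=> a b _ _; apply: perm_inj.
have gXfX i : galg_char 'chi_i (mset_sum XfX) = pX i + pfX i.
  by rewrite mset_sumD galg_charD -galg_map_set gX gfX.
have eqn i := dsrg_character_equations sXA hY bA defG b2A fA hconj
  (lin_char1 (lin i)) (lin_charM (lin i)) (@cfun0 _ _ 'chi_i) hdsrg.
(* The first equation for [chi o f]. As [f] is an involution, its [Y] term still has [pY i] as a
   factor and vanishes. *)
have eqnf i : pY i = 0 -> i != 0 -> pfX i ^+ 2 = t%:R - mu%:R + lm * pfX i.
  move=> pY0 nz_i.
  have [|a c aA cA|g gA|E _] := dsrg_character_equations
    (phi := fun a => 'chi_i (f a)) sXA hY bA defG b2A fA hconj _ _ _ hdsrg.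
  - by rewrite -[f _]/(autm hf _) morph1 (lin_char1 (lin i)).
  - by rewrite -!(autmE hf) morphM // (lin_charM (lin i)) ?autmE ?fA.
  - by rewrite (out_Aut hf) // cfun0.
  move: E; under [X in _ + X * _ * _]eq_bigr do rewrite fK.
  rewrite -/(pfX i) -/(pY i) pY0 [X in _ + mu%:R * X](_ : _ = 0).
    by rewrite !(mulr0, mul0r) !addr0 -/lm.
  rewrite -[RHS](sum_nontrivial_irr nz_i) [RHS](reindex_inj (@perm_inj _ f)).
  by apply: eq_bigl => a; apply/idP/idP=> /fA; rewrite ?fK.
(* Both equations at the trivial character, where the [mu * #|A|] terms remain. *)
have [E1 E2] : (#|X|%:R ^+ 2 + #|Y|%:R ^+ 2
      = t%:R - mu%:R + lm * #|X|%:R + mu%:R * #|A|%:R :> algC)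
    /\ (#|Y|%:R * (#|X|%:R + #|X|%:R) = lm * #|Y|%:R + mu%:R * #|A|%:R :> algC).
  have := eqn 0; rewrite !(sum_irr0 (h := id)) //; [|exact/subsetP|exact/subsetP].
  rewrite !(sum_irr0 (h := f)); first last.
  - by move=> z /(subsetP hY)/fA.
  - by move=> z /(subsetP sXA)/fA.
  by rewrite irr0 cfun1E b2A mulr1 -expr2.
have xy_root : xy ^+ 2 = t%:R - mu%:R + lm * xy.
  rewrite /xy mulrBr addrA; apply/eqP; rewrite -subr_eq0; apply/eqP.
  transitivity ((#|X|%:R ^+ 2 + #|Y|%:R ^+ 2
    - (t%:R - mu%:R + lm * #|X|%:R + mu%:R * #|A|%:R))
    - (#|Y|%:R * (#|X|%:R + #|X|%:R) - (lm * #|Y|%:R + mu%:R * #|A|%:R)) : algC).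
    by ring.
  by rewrite E1 E2 !subrr.
have pXfX i : i != 0 -> pY i != 0 -> pX i + pfX i = lm.
  move=> nz_i nzY; apply: (mulfI nzY); have [_ ->] := eqn i.
  by rewrite sum_nontrivial_irr // mulr0 addr0 mulrC.
have pX_root i : i != 0 -> pY i = 0 ->
    pX i \in [:: xy; lm - xy] /\ pfX i \in [:: xy; lm - xy].
  move=> nz_i pY0; split; apply: (mem_quadratic_roots xy_root); last exact: eqnf.
  have [+ _] := eqn i; rewrite -/(pX i) -/(pY i) pY0 mulr0 mul0r.
  by rewrite sum_nontrivial_irr // mulr0 !addr0.
(* When [pY i = 0], equal roots give the doubled values, while distinct choices add up to [lm]. *)
have pXfX_mem i : i != 0 -> pX i + pfX i \in [:: lm; 2 * xy; 2 * (lm - xy)].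
  move=> nz_i; have [/(pX_root i nz_i)[]|/(pXfX i nz_i)->] := eqVneq (pY i) 0.
    rewrite !inE => /orP[]/eqP-> /orP[]/eqP->.
    - by rewrite [2 * xy]mulr_natl mulr2n eqxx orbT.
    - by rewrite [xy + _]addrC subrK eqxx.
    - by rewrite subrK eqxx.
    - by rewrite [2 * (lm - xy)]mulr_natl mulr2n eqxx !orbT.
  by rewrite inE eqxx.
have pXfX0 : pX 0 + pfX 0 = xx.
  rewrite /pX (sum_irr0 (h := id)) ?/pfX ?(sum_irr0 (h := f)); last exact/subsetP.
    by rewrite /xx mulr_natl mulr2n.
  by move=> z /(subsetP sXA)/fA.

(* Inverse closure and the spectrum *)
have sym : inverse_closed XfX.
  move=> a; case aA: (a \in A); last first.
    have out (Z : {set gT}) b : Z \subset A -> b \notin A -> mset_of Z b = 0%N.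
      by move=> sZA bA'; rewrite /mset_of (contraNF (subsetP sZA b) bA').
    by rewrite /XfX /mset_union !out // ?groupV ?aA.
  have := real_galg_char_sym (c := mset_sum XfX) hAab _ _ aA.
  rewrite !ffunE => eqD; apply/eqP; rewrite -(eqr_nat algC); apply/eqP/eqD.
    by move=> b; rewrite ffunE realn.
  have rlm : lm \is Num.real by rewrite rpredB ?realn.
  have rxy : xy \is Num.real by rewrite rpredB ?realn.
  move=> i; rewrite gXfX; have [->|nz_i] := eqVneq i 0.
    by rewrite pXfX0 rpredM ?realn.
  have := pXfX_mem i nz_i; rewrite !inE => /or3P[]/eqP-> //.
    by rewrite rpredM ?realn.
  by rewrite rpredM ?realn //; apply: rpredB.
(* Removing index [0] leaves the nontrivial characters; the trivial one accounts for [xx]. *)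
pose s := [seq pX i + pfX i | i <- rem 0 (index_enum (Iirr A))].
have specG : spectrum Gamma' (xx :: s).
  rewrite /spectrum char_poly_cay_abelian // -pXfX0 big_cons big_map.
  rewrite (big_rem 0) ?mem_index_enum //= gXfX.
  by congr (_ * _); apply: eq_bigr => i _; rewrite gXfX.
have memS z : reflect (exists2 i, i != 0 & z = pX i + pfX i) (z \in s).
  apply: (iffP mapP) => [][i]; rewrite rem_filter ?index_enum_uniq //.
    by rewrite mem_filter => /andP[nz_i _] ->; exists i.
  by move=> nz_i ->; exists i; rewrite // mem_filter /= nz_i mem_index_enum.
have sub_s : {subset s <= [:: lm; 2 * xy; 2 * (lm - xy)]}.
  by move=> z /memS[i nz_i ->]; apply: pXfX_mem.
have eigG z : eigenvalue Gamma' z = (z \in xx :: s).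
  by rewrite eigenvalue_root_char specG root_prod_XsubC.

(* Separating [2|X|] from the other eigenvalues *)
have mu_gt0 : (0 < mu)%N.
  apply: dsrg_cay_mu_gt0 hdsrg; rewrite defG.
  by rewrite setUSS ?mulSg.
have muA : mu%:R * #|A|%:R != 0 :> algC.
  by rewrite -natrM pnatr_eq0 -lt0n muln_gt0 mu_gt0 cardG_gt0.
(* If [2|X| = lm], the two [lm * |Y|] terms of [E2] cancel and force [mu * |A| = 0]. *)
have xx_neq_lm : xx != lm.
  apply: contraNneq muA => exx.
  have exx2 : #|X|%:R + #|X|%:R = lm by rewrite -exx /xx mulr_natl mulr2n.
  move: E2; rewrite exx2 mulrC => /eqP.
  by rewrite -subr_eq0 opprD addNKr oppr_eq0.
have Y_neq0 : #|Y|%:R != 0 :> algC.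
  by apply: contraNneq muA => Y0; move: E2; rewrite Y0 mul0r mulr0 add0r => <-.
have xx_neq_xy : xx != 2 * xy.
  apply: contra Y_neq0; rewrite /xx /xy -subr_eq0.
  rewrite (_ : _ - _ = 2 * #|Y|%:R); last by ring.
  by rewrite mulf_eq0 pnatr_eq0.
have mupG : xx \notin s -> mup xx (char_poly Gamma') = 1%N.
  move=> xxs; rewrite specG mu_prod_XsubC /= eqxx.
  by rewrite (count_memPn xxs).
split=> [i nz_i|].
  rewrite galg_charD gX gfX gY; split=> [|pY0]; first exact: pXfX.
  exact: pX_root.
split; first by split=> // x y _ _; rewrite /cay_arcs -[RHS]sym invMg invgK.
split=> [z|].
  rewrite eigG inE => /orP[/eqP->|/sub_s]; first by rewrite inE eqxx.
  by rewrite [in X in _ -> X]inE => ->; rewrite orbT.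
split; first by exists s.
split=> [xx_neq|].
  apply: mupG; apply/negP=> /sub_s.
  by rewrite !inE (negPf xx_neq_lm) (negPf xx_neq_xy) (negPf xx_neq).
move=> allY.
have s_lm z : z \in s -> z = lm.
  by case/memS=> i nz_i ->; apply: pXfX; rewrite // -gY allY.
split=> // [z|]; last by apply: mupG; apply: contra xx_neq_lm => /s_lm->.
rewrite eigG inE; split=> [/orP[/eqP|/s_lm]|[->|->]];
  [by left|by right|by rewrite eqxx|].
(* Since [|A| = n > 1], a nontrivial character exists, so [lm] really occurs as an eigenvalue. *)
have lt1N : (1 < Nirr A)%N.
  rewrite NirrE (eqP (etrans (esym (card_classes_abelian A)) hAab)).
  have := Lagrange sAG; rewrite hAidx hG mulnC => /eqP; rewrite eqn_pmul2l //.
  by move/eqP->.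
pose i1 : Iirr A := Ordinal lt1N.
have nz1 : i1 != 0 by [].
apply/orP; right; apply/memS; exists i1 => //.
by rewrite pXfX // -gY allY.
Qed.
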